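(* (1) The Holevo–Werner channel $W_5^-$ has an exact factorization through $M_5(\mathbb{C})\otimes M_4(\mathbb{C})$, i.e. there is a unitary $u\in M_5(\mathbb{C})\otimes M_4(\mathbb{C})$ with $W_5^-(x)=(\mathrm{id}_5\otimes\tau_4)(u^*(x\otimes 1_4)u)$ for all $x\in M_5(\mathbb{C})$. (2) For every odd integer $n\geq 5$, $W_n^-$ is factorizable of degree $4$, i.e. $W_n^-\otimes S_4\in\mathrm{conv}(\mathrm{Aut}(M_n(\mathbb{C})\otimes M_4(\mathbb{C})))$.
   Context: For $n\geq 2$, the Holevo–Werner channel $W_n^-:M_n(\mathbb{C})\to M_n(\mathbb{C})$ is $W_n^-(x)=\frac{1}{n-1}(\mathrm{Tr}_n(x)1_n-x^t)$, where $\mathrm{Tr}_n$ is the (non-normalized) trace and $x^t$ the transpose. $\tau_k$ is the normalized trace on $M_k(\mathbb{C})$ and $S_k(y)=\tau_k(y)1_k$ is the completely depolarizing channel on $M_k(\mathbb{C})$. $\mathrm{Aut}(M_m(\mathbb{C}))$ is the set of maps $x\mapsto u^*xu$ with $u$ unitary, $\mathrm{conv}$ denotes convex hull, and $M_n(\mathbb{C})\otimes M_4(\mathbb{C})$ is identified with $M_{4n}(\mathbb{C})$. *)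

(* Defs.v *)
From mathcomp Require Import all_boot all_algebra.
From mathcomp Require Import complex mxtens.
From mathcomp Require Import Rstruct.
Set Implicit Arguments.
Unset Strict Implicit.
Unset Printing Implicit Defensive.
Import GRing.Theory Num.Theory.
Local Open Scope ring_scope.

Definition C : numClosedFieldType := (Rdefinitions.R)[i].

Definition adj (m : nat) (A : 'M[C]_m) : 'M[C]_m := (map_mx Num.conj A)^T.

Definition unitary (m : nat) (u : 'M[C]_m) : Prop :=
  u *m adj u = 1%:M /\ adj u *m u = 1%:M.

Definition autconj (m : nat) (u : 'M[C]_m) (x : 'M[C]_m) : 'M[C]_m :=
  adj u *m x *m u.

Definition ntr (k : nat) (y : 'M[C]_k) : C := \tr y / k%:R.

Definition Sdep (k : nat) (y : 'M[C]_k) : 'M[C]_k := ntr y *: 1%:M.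

Definition Wminus (n : nat) (x : 'M[C]_n) : 'M[C]_n :=
  ((n - 1)%:R)^-1 *: (\tr x *: 1%:M - x^T).

(* M_n (x) M_k is identified with M_(n*k) via the Kronecker product
   convention of mxtens (index (i,a) |-> i*k + a). *)
Definition idx (n k : nat) (i : 'I_n) (a : 'I_k) : 'I_(n * k) :=
  mxtens_index (i, a).

Definition id_tens_tau (n k : nat) (X : 'M[C]_(n * k)) : 'M[C]_n :=
  \matrix_(i, j) ((k%:R)^-1 * \sum_(a < k) X (idx i a) (idx j a)).

Definition tensmap (n k : nat) (Phi : 'M[C]_n -> 'M[C]_n)
  (Psi : 'M[C]_k -> 'M[C]_k) (X : 'M[C]_(n * k)) : 'M[C]_(n * k) :=
  \sum_(i < n) \sum_(j < n) \sum_(a < k) \sum_(b < k)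
     X (idx i a) (idx j b) *: (Phi (delta_mx i j) *t Psi (delta_mx a b)).

Definition in_conv_Aut (m : nat) (T : 'M[C]_m -> 'M[C]_m) : Prop :=
  exists (N : nat) (lam : 'I_N -> C) (U : 'I_N -> 'M[C]_m),
    (forall t, 0 <= lam t) /\ \sum_(t < N) lam t = 1 /\
    (forall t, unitary (U t)) /\
    (forall x, T x = \sum_(t < N) lam t *: autconj (U t) x).

(* Main.v *)
(** The maps [x |-> a_ij^* x a_ij] with [a_ij = e_ij - e_ji], [i < j], sum to
    [(n - 1) W_n^-].  So a unitary [u] in [M_n (x) M_k] whose [k x k] blocks
    satisfy [u_ji = - u_ij] factorizes [W_n^-] exactly as soon as its blocks
    with [i < j] are orthogonal of equal norm for the trace.

    For [n = 5], [k = 4] take [u_ij = w_ij g_i g_j / 2], with [g_1, ..., g_5]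
    anticommuting real signed permutation matrices of size 4 and [w] a
    symmetric conference matrix of order 5 whose off-diagonal entries are cube
    roots of unity.  The ten products [g_i g_j], [i < j], are orthogonal, and unitarity
    of [u] reduces to the orthogonality of the rows of [w].

    For larger odd [n], add blocks [[0, 1], [-1, 0]] to [u].  The result is still
    unitary with antisymmetric blocks.  Conjugating it by random signed
    permutations of the [n] block indices kills the cross terms between distinct
    pairs [{i, j}] and equalizes the weights of the pairs; multiplying it on
    both sides by independent random signed permutations of [M_k] yields the
    factor [S_k]. *)

Require Import Defs.
From mathcomp Require Import all_boot all_algebra all_fingroup.
From mathcomp Require Import complex mxtens.
From mathcomp Require Import ring.
Set Implicit Arguments.
Unset Strict Implicit.
Unset Printing Implicit Defensive.
Import GRing.Theory Num.Theory.
Local Open Scope ring_scope.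

(* Otherwise [/=] unfolds [C] to [R[i]], which blocks structure inference. *)
Local Opaque C.

(** * Coordinates on the tensor product and averages of conjugations *)

Lemma sum_idx (n k : nat) (F : 'I_(n * k) -> C) :
  \sum_x F x = \sum_(i < n) \sum_(a < k) F (idx i a).
Proof.
rewrite pair_big /= (reindex (@mxtens_index n k)) /=; last first.
  exists (@mxtens_unindex n k) => x _; [exact: mxtens_indexK|exact: mxtens_unindexK].
by apply: eq_bigr => -[i a] _.
Qed.

Lemma idx_eq (n k : nat) (i j : 'I_n) (a b : 'I_k) :
  (idx i a == idx j b) = (i == j) && (a == b).
Proof. by rewrite /idx (inj_eq (can_inj (@mxtens_indexK n k))) -pair_eqE. Qed.

Lemma unitaryP (m : nat) (u : 'M[C]_m) :
  (forall x y, \sum_z u x z * (u y z)^* = (x == y)%:R) -> unitary u.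
Proof.
move=> uP; have uu : u *m adj u = 1%:M.
  apply/matrixP => x y; rewrite !mxE -uP; apply: eq_bigr => z _.
  by rewrite !mxE.
by split=> //; apply: mulmx1C.
Qed.

Lemma autconjE (m : nat) (u X : 'M[C]_m) x y :
  autconj u X x y = \sum_z \sum_w X z w * ((u z x)^* * u w y).
Proof.
rewrite mxE exchange_big; apply: eq_bigr => w _; rewrite mxE mulr_suml.
by apply: eq_bigr => z _; rewrite !mxE mulrCA !mulrA.
Qed.

Lemma in_conv_Aut_average (m : nat) (T : finType) (V : T -> 'M[C]_m)
    (Phi : 'M[C]_m -> 'M[C]_m) :
  (0 < #|T|)%N -> (forall t, unitary (V t)) ->
  (forall x, Phi x = (#|T|%:R)^-1 *: \sum_t autconj (V t) x) ->
  in_conv_Aut Phi.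
Proof.
move=> T0 VU PhiE; exists #|T|, (fun=> (#|T|%:R)^-1), (fun i => V (enum_val i)).
split=> [t|]; first by rewrite invr_ge0 ler0n.
split; first by rewrite sumr_const card_ord -[LHS]mulr_natl mulfV // pnatr_eq0 -lt0n.
split=> [t|x]; first exact: VU.
by rewrite PhiE scaler_sumr (big_enum_val (fun t => _ *: autconj (V t) x)).
Qed.

Lemma eq_oppr_eq0 (x : C) : x = - x -> x = 0.
Proof. by move=> xN; apply/eqP; rewrite -eqNr -xN. Qed.

(** * Averages over signed permutations *)

Definition sperm (n : nat) : finType := ({ffun 'I_n -> bool} * 'S_n)%type.

Definition sg (n : nat) (s : sperm n) (i : 'I_n) : C := (-1) ^+ s.1 i.

Lemma sg_sqr n (s : sperm n) i : sg s i * sg s i = 1.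
Proof. by rewrite /sg -expr2 sqrr_sign. Qed.

Lemma sg_conj n (s : sperm n) i : (sg s i)^* = sg s i.
Proof. by rewrite /sg rmorph_sign. Qed.

Lemma card_sperm_gt0 n : (0 < #|sperm n|)%N.
Proof. by apply/card_gt0P; exists ([ffun=> false], 1%g). Qed.

Definition flip (n : nat) (m : 'I_n) (s : sperm n) : sperm n :=
  ([ffun x => s.1 x (+) (x == m)], s.2).

Lemma flipK n (m : 'I_n) : involutive (flip m).
Proof.
move=> [e p]; congr (_, _); apply/ffunP => x /=.
by rewrite !ffunE /= -addbA addbb addbF.
Qed.

Lemma sg_flip n (m : 'I_n) s x : sg (flip m s) x = (-1) ^+ (x == m) * sg s x.
Proof. by rewrite /sg ffunE signr_addb mulrC. Qed.

Lemma sum_flip_eq0 n (m : 'I_n) (F : sperm n -> C) :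
  (forall s, F (flip m s) = - F s) -> \sum_s F s = 0.
Proof.
move=> FN; apply: eq_oppr_eq0; rewrite {1}(reindex_inj (inv_inj (flipK m))).
by rewrite -sumrN; apply: eq_bigr => s _; rewrite FN.
Qed.

(** Left multiplication acts on the argument of the permutation, so it exchanges [i] and [j]; the
    signs stay fixed. *)
Lemma sum_tperm n (i j : 'I_n) (F : 'S_n -> C) :
  \sum_(s : sperm n) F s.2 = \sum_(s : sperm n) F (tperm i j * s.2)%g.
Proof.
have tK : involutive (fun s : sperm n => (s.1, (tperm i j * s.2)%g)).
  by move=> [e p]; rewrite /= mulgA tperm2 mul1g.
by rewrite (reindex_inj (inv_inj tK)).
Qed.

(** For [a != c], flipping the sign at [a] negates every term. For [a = c], transpositions make the
    sum independent of [a], so it equals its mean over [a]. *)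
Lemma sum_sperm2 k (F : 'I_k -> 'I_k -> C) (a c : 'I_k) :
  \sum_(s : sperm k) sg s a * sg s c * F (s.2 a) (s.2 c) =
  (a == c)%:R * (#|sperm k|%:R / k%:R) * \sum_d F d d.
Proof.
have [<-|ac] := eqVneq a c; last first.
  rewrite !mul0r (@sum_flip_eq0 _ a) // => s.
  by rewrite !sg_flip eqxx eq_sym (negPf ac) mul1r expr1; ring.
pose K b := \sum_(s : sperm k) F (s.2 b) (s.2 b).
have KE b : K b = K a.
  rewrite /K (sum_tperm b a (fun p => F (p b) (p b))).
  by apply: eq_bigr => s _; rewrite permM tpermL.
have sumK : \sum_b K b = #|sperm k|%:R * \sum_d F d d.
  rewrite exchange_big /= mulr_natl -sumr_const.
  by apply: eq_bigr => s _; rewrite [RHS](reindex_inj (@perm_inj _ s.2)).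
have k0 : k%:R != 0 :> C by rewrite pnatr_eq0 -lt0n (leq_ltn_trans _ (ltn_ord a)).
rewrite (eq_bigr (fun s : sperm k => F (s.2 a) (s.2 a))); last first.
  by move=> s _; rewrite sg_sqr mul1r.
rewrite -/(K a); move: sumK; rewrite (eq_bigr (fun=> K a)) // sumr_const card_ord.
by rewrite mul1r mulrAC => <-; rewrite -[K a *+ _]mulr_natr mulfK.
Qed.

(** Signs kill the quadruples with an index of odd multiplicity, antisymmetry those with [i = j] or
    [k = l]. The rest have [{i, j} = {k, l}] and, up to sign, a common value given by the third
    hypothesis. *)
Lemma sum_sperm4 n (G : 'I_n -> 'I_n -> 'I_n -> 'I_n -> C) (i j k l : 'I_n) :
  (forall i j k l, G i j k l = - G j i k l) ->
  (forall i j k l, G i j k l = - G i j l k) ->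
  (forall i, \sum_j G i j i j = 1) ->
  \sum_(s : sperm n) sg s i * sg s j * sg s k * sg s l *
     G (s.2 i) (s.2 j) (s.2 k) (s.2 l) =
  #|sperm n|%:R / (n - 1)%:R *
    ((i == k)%:R * (j == l)%:R - (i == l)%:R * (j == k)%:R).
Proof.
move=> GN1 GN2 Gsum.
pose B i j k l := \sum_(s : sperm n) sg s i * sg s j * sg s k * sg s l *
     G (s.2 i) (s.2 j) (s.2 k) (s.2 l).
rewrite -/(B i j k l).
have BN1 i' j' k' l' : B i' j' k' l' = - B j' i' k' l'.
  by rewrite /B -sumrN; apply: eq_bigr => s _; rewrite GN1; ring.
have BN2 i' j' k' l' : B i' j' k' l' = - B i' j' l' k'.
  by rewrite /B -sumrN; apply: eq_bigr => s _; rewrite GN2; ring.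
have diag i' j' : i' != j' -> B i' j' i' j' = #|sperm n|%:R / (n - 1)%:R.
  move=> ij; have n1 : (1 < n)%N.
    by rewrite -(card_ord n); apply/card_gt1P; exists i', j'.
  (* [K] vanishes at [i'], is constant elsewhere and has total [#|sperm n|]; hence the denominator
     [n - 1]. *)
  pose K x := \sum_(s : sperm n) G (s.2 i') (s.2 x) (s.2 i') (s.2 x).
  have -> : B i' j' i' j' = K j'.
    apply: eq_bigr => s _; rewrite -[RHS]mul1r; congr (_ * _).
    by rewrite -[RHS](mulr1 1) -{1}(sg_sqr s i') -(sg_sqr s j'); ring.
  have KE x : x != i' -> K x = K j'.
    move=> xi; rewrite /K.
    rewrite (sum_tperm x j' (fun p => G (p i') (p x) (p i') (p x))).
    by apply: eq_bigr => s _; rewrite !permM tpermL tpermD // eq_sym.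
  have K0 : K i' = 0.
    by apply: big1 => s _; apply: eq_oppr_eq0; rewrite {1}GN1.
  have : \sum_x K x = #|sperm n|%:R.
    rewrite exchange_big /= -[RHS]mulr1 mulr_natl -sumr_const.
    apply: eq_bigr => s _; rewrite -(Gsum (s.2 i')).
    by rewrite [RHS](reindex_inj (@perm_inj _ s.2)).
  rewrite (bigD1 i') //= K0 add0r (eq_bigr (fun=> K j')) // => <-.
  rewrite sumr_const cardC1 card_ord subn1 -[K j' *+ _]mulr_natr mulfK //.
  by rewrite pnatr_eq0 -subn1 subn_eq0 -ltnNge.
(* The xor is the parity of the multiplicity of [m]. *)
have B0 i' j' k' l' (m : 'I_n) :
    (i' == m) (+) (j' == m) (+) (k' == m) (+) (l' == m) -> B i' j' k' l' = 0.
  move=> odd_m; apply: (@sum_flip_eq0 _ m) => s; rewrite !sg_flip.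
  have oddE : (-1) ^+ (i' == m) * (-1) ^+ (j' == m) * (-1) ^+ (k' == m) *
            (-1) ^+ (l' == m) = -1 :> C by rewrite -!signr_addb odd_m.
  by rewrite -[RHS]mulN1r -[in RHS]oddE; ring.
have [eij|ij] := eqVneq i j.
  have -> : B i j k l = 0.
    by apply: eq_oppr_eq0; rewrite {1}BN1 eij.
  by rewrite eij; ring.
have [ekl|kl] := eqVneq k l.
  have -> : B i j k l = 0.
    by apply: eq_oppr_eq0; rewrite {1}BN2 ekl.
  by rewrite ekl; ring.
(* From here on, unless the two pairs coincide, [i] or [j] occurs exactly once. *)
have [eik|ik] := eqVneq i k.
  subst k; rewrite (negPf kl) mul0r subr0 mul1r.
  have [<-|jl] := eqVneq j l; first by rewrite diag // mulr1.
  by rewrite mulr0 (B0 _ _ _ _ j) // eqxx (negPf ij) eq_sym (negPf jl).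
have [eil|il] := eqVneq i l.
  subst l; rewrite !mul0r mul1r sub0r.
  have [<-|jk] := eqVneq j k; first by rewrite BN2 diag // mulrN1.
  rewrite oppr0 mulr0 (B0 _ _ _ _ j) //.
  by rewrite eqxx (negPf ij) eq_sym (negPf jk).
rewrite !mul0r subrr mulr0 (B0 _ _ _ _ i) //.
by rewrite eqxx ![_ == i]eq_sym (negPf ij) (negPf ik) (negPf il).
Qed.

(** * Unitaries with antisymmetric blocks *)

Definition blockmx (n k : nat) (f : 'I_n -> 'I_n -> 'I_k -> 'I_k -> C) :
    'M[C]_(n * k) :=
  \matrix_(x, y) f (mxtens_unindex x).1 (mxtens_unindex y).1
                   (mxtens_unindex x).2 (mxtens_unindex y).2.

Lemma blockmxE (n k : nat) (f : 'I_n -> 'I_n -> 'I_k -> 'I_k -> C) i j a b :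
  blockmx f (idx i a) (idx j b) = f i j a b.
Proof. by rewrite mxE !mxtens_indexK. Qed.

Definition row_orthonormal (n k : nat)
    (f : 'I_n -> 'I_n -> 'I_k -> 'I_k -> C) : Prop :=
  forall i i' a a', \sum_j \sum_b f i j a b * (f i' j a' b)^* =
                    ((i == i') && (a == a'))%:R.

Lemma unitary_blockmx (n k : nat) (f : 'I_n -> 'I_n -> 'I_k -> 'I_k -> C) :
  row_orthonormal f -> unitary (blockmx f).
Proof.
move=> fO; apply: unitaryP => x y.
rewrite sum_idx; case: (mxtens_indexP x) => i a; case: (mxtens_indexP y) => i' a'.
rewrite -![mxtens_index _]/(idx _ _) idx_eq -fO.
by apply: eq_bigr => j _; apply: eq_bigr => b _; rewrite !blockmxE.
Qed.

(** The blocks enter only through their trace inner products. *)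
Lemma id_tens_tauE (n k : nat) (f : 'I_n -> 'I_n -> 'I_k -> 'I_k -> C) (x : 'M_n) j l :
  id_tens_tau (autconj (blockmx f) (x *t (1%:M : 'M[C]_k))) j l =
  k%:R^-1 * \sum_i \sum_i' x i i' *
    \sum_a \sum_b (f i j a b)^* * f i' l a b.
Proof.
rewrite mxE; congr (_ * _).
under eq_bigr => b _.
  rewrite autconjE sum_idx.
  under eq_bigr => i _.
    under eq_bigr => a _.
      rewrite sum_idx.
      under eq_bigr => i' _.
        rewrite (bigD1 a) //= big1 ?addr0 => [|a' /negPf a'a]; last first.
          by rewrite tensmxE !mxE eq_sym a'a mulr0 mul0r.
        rewrite tensmxE !blockmxE !mxE eqxx mulr1.
        over.
      over.
    rewrite exchange_big; over.
  over.
rewrite exchange_big; apply: eq_bigr => i _.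
rewrite exchange_big; apply: eq_bigr => i' _.
rewrite exchange_big mulr_sumr; apply: eq_bigr => a _.
by rewrite mulr_sumr.
Qed.

Lemma tensmap_Wminus_SdepE (n k : nat) (X : 'M[C]_(n * k)) j b l d :
  tensmap (@Wminus n) (@Sdep k) X (idx j b) (idx l d) =
  \sum_i \sum_i' \sum_a \sum_a' X (idx i a) (idx i' a') *
   (((n - 1)%:R)^-1 * ((i == i')%:R * (j == l)%:R - (i == l)%:R * (j == i')%:R) *
    ((a == a')%:R / k%:R * (b == d)%:R)).
Proof.
rewrite /tensmap summxE; apply: eq_bigr => i _.
rewrite summxE; apply: eq_bigr => i' _.
rewrite summxE; apply: eq_bigr => a _.
rewrite summxE; apply: eq_bigr => a' _.
have trd m (x y : 'I_m) : \tr (delta_mx x y) = (x == y)%:R :> C.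
  rewrite /mxtrace (bigD1 x) //= big1 => [|z /negPf zx]; last by rewrite mxE zx.
  by rewrite mxE eqxx addr0.
rewrite mxE tensmxE /Wminus /Sdep /ntr !trd !mxE.
by rewrite [l == i]eq_sym -mulnb natrM.
Qed.

(** * Twisting by random signed permutations *)

Section Average.

Variables (n k : nat) (f : 'I_n -> 'I_n -> 'I_k -> 'I_k -> C).
Hypothesis f_skew : forall i j a b, f i j a b = - f j i a b.
Hypothesis f_orth : row_orthonormal f.

(** The same [t.1] acts on block rows and block columns, which keeps the blocks antisymmetric;
    inside the blocks the two sides are independent. *)
Definition twist (t : sperm n * (sperm k * sperm k)) i j a b : C :=
  sg t.1 i * sg t.1 j * (sg t.2.1 a * sg t.2.2 b) *
  f (t.1.2 i) (t.1.2 j) (t.2.1.2 a) (t.2.2.2 b).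

Lemma twist_orth t : row_orthonormal (twist t).
Proof.
case: t => s [p q] i i' a a'.
(* Row signs square to 1 on the diagonal; off it both sides vanish. *)
have -> : ((i == i') && (a == a'))%:R =
    sg s i * sg s i' * (sg p a * sg p a') *
    ((s.2 i == s.2 i') && (p.2 a == p.2 a'))%:R.
  rewrite !(inj_eq perm_inj).
  have [<-|] := eqVneq i i'; last by rewrite mulr0.
  have [<-|] := eqVneq a a'; last by rewrite mulr0.
  by rewrite !sg_sqr !mulr1.
rewrite -f_orth [in RHS](reindex_inj (@perm_inj _ s.2)) mulr_sumr.
apply: eq_bigr => j _; rewrite [in RHS](reindex_inj (@perm_inj _ q.2)) mulr_sumr.
apply: eq_bigr => b _; rewrite /twist /= !rmorphM /= !sg_conj.
by have sj := sg_sqr s j; have qb := sg_sqr q b; ring: sj qb.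
Qed.

Lemma twist_average i j k' l a b c d :
  \sum_t (twist t i j a b)^* * twist t k' l c d =
  #|{: sperm n * (sperm k * sperm k)}|%:R *
   (((n - 1)%:R)^-1 * ((i == k')%:R * (j == l)%:R - (i == l)%:R * (j == k')%:R) *
    ((a == c)%:R / k%:R * (b == d)%:R)).
Proof.
pose G i j i' j' := k%:R^-1 * \sum_a \sum_b (f i j a b)^* * f i' j' a b.
have k0 : k%:R != 0 :> C by rewrite pnatr_eq0 -lt0n (leq_ltn_trans _ (ltn_ord a)).
have GN1 i1 i2 i3 i4 : G i1 i2 i3 i4 = - G i2 i1 i3 i4.
  rewrite /G -mulrN -sumrN; congr (_ * _); apply: eq_bigr => a' _.
  by rewrite -sumrN; apply: eq_bigr => b' _; rewrite f_skew rmorphN mulNr.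
have GN2 i1 i2 i3 i4 : G i1 i2 i3 i4 = - G i1 i2 i4 i3.
  rewrite /G -mulrN -sumrN; congr (_ * _); apply: eq_bigr => a' _.
  by rewrite -sumrN; apply: eq_bigr => b' _; rewrite [f i3 _ _ _]f_skew mulrN.
(* Each of the [k] rows through block row [i1] has norm 1. *)
have Gsum i1 : \sum_i2 G i1 i2 i1 i2 = 1.
  rewrite -mulr_sumr exchange_big /= (eq_bigr (fun=> 1)) => [|a' _].
    by rewrite sumr_const card_ord mulVf.
  transitivity (((i1 == i1) && (a' == a'))%:R : C); last by rewrite !eqxx.
  rewrite -f_orth.
  by apply: eq_bigr => i2 _; apply: eq_bigr => b' _; rewrite mulrC.
have := sum_sperm4 i j k' l GN1 GN2 Gsum.
have cardT : #|{: sperm n * (sperm k * sperm k)}| =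
    (#|sperm n| * (#|sperm k| * #|sperm k|))%N.
  by rewrite card_prod (card_prod (sperm k)).
rewrite cardT !natrM => B4.
transitivity (\sum_(s : sperm n) \sum_(p : sperm k) \sum_(q : sperm k)
   (twist (s, (p, q)) i j a b)^* * twist (s, (p, q)) k' l c d).
  under [RHS]eq_bigr => s _ do rewrite pair_big.
  by rewrite pair_big; apply: eq_bigr => -[s [p q]] _.
(* The sums over [p] and [q] each give a factor [1 / k]; one of them is absorbed in [G]. *)
transitivity (\sum_(s : sperm n) sg s i * sg s j * sg s k' * sg s l *
   G (s.2 i) (s.2 j) (s.2 k') (s.2 l) *
   ((a == c)%:R * #|sperm k|%:R / k%:R * ((b == d)%:R * #|sperm k|%:R))).
  apply: eq_bigr => s _.
  transitivity (sg s i * sg s j * sg s k' * sg s l *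
    \sum_(p : sperm k) sg p a * sg p c * \sum_(q : sperm k) sg q b * sg q d *
     ((f (s.2 i) (s.2 j) (p.2 a) (q.2 b))^* *
      f (s.2 k') (s.2 l) (p.2 c) (q.2 d))).
    rewrite mulr_sumr; apply: eq_bigr => p _.
    rewrite !mulr_sumr; apply: eq_bigr => q _.
    by rewrite /twist /= !rmorphM /= !sg_conj; ring.
  under eq_bigr => p _.
    rewrite (sum_sperm2 (fun b d => (f (s.2 i) (s.2 j) (p.2 a) b)^* *
      f (s.2 k') (s.2 l) (p.2 c) d)).
    over.
  rewrite (sum_sperm2 (fun a c => (b == d)%:R * (#|sperm k|%:R / k%:R) *
    \sum_b' (f (s.2 i) (s.2 j) a b')^* * f (s.2 k') (s.2 l) c b')).
  rewrite /= -mulr_sumr /G.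
  by ring.
rewrite -mulr_suml B4.
by ring.
Qed.

Lemma in_conv_Aut_Wminus_Sdep : in_conv_Aut (tensmap (@Wminus n) (@Sdep k)).
Proof.
have T0 : (0 < #|{: sperm n * (sperm k * sperm k)}|)%N.
  by rewrite card_prod (card_prod (sperm k)) !muln_gt0 !card_sperm_gt0.
apply: (in_conv_Aut_average (V := fun t => blockmx (twist t))) => // [t|X].
  exact/unitary_blockmx/twist_orth.
apply/matrixP => x y; case: (mxtens_indexP x) => j b; case: (mxtens_indexP y) => l d.
rewrite -![mxtens_index _]/(idx _ _) tensmap_Wminus_SdepE mxE summxE.
under [in RHS]eq_bigr => t _.
  rewrite autconjE sum_idx.
  under eq_bigr => i _.
    under eq_bigr => a _.
      rewrite sum_idx.
      under eq_bigr => i' _ do under eq_bigr => a' _ do rewrite !blockmxE.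
      over.
    rewrite exchange_big.
    over.
  over.
rewrite [in RHS]exchange_big mulr_sumr; apply: eq_bigr => i _.
rewrite [in RHS]exchange_big mulr_sumr; apply: eq_bigr => i' _.
rewrite [in RHS]exchange_big mulr_sumr; apply: eq_bigr => a _.
rewrite [in RHS]exchange_big mulr_sumr; apply: eq_bigr => a' _.
rewrite -mulr_sumr twist_average [RHS]mulrCA; congr (_ * _).
by rewrite mulKf // pnatr_eq0 -lt0n.
Qed.

End Average.

(** * The unitary of order 5, over the Eisenstein integers *)

(* [(a, b)] stands for [a + b w], with [w] a primitive cube root of unity. *)
Definition eis := (int * int)%type.

Definition eadd (x y : eis) : eis := (x.1 + y.1, x.2 + y.2).
(** Reduced by [w ^ 2 = - 1 - w], which is also the conjugate of [w]. *)
Definition emul (x y : eis) : eis :=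
  (x.1 * y.1 - x.2 * y.2, x.1 * y.2 + x.2 * y.1 - x.2 * y.2).
Definition econj (x : eis) : eis := (x.1 - x.2, - x.2).
Definition eint (m : int) : eis := (m, 0).
Definition esum (m : nat) (F : nat -> eis) : eis :=
  foldr (fun i => eadd (F i)) (eint 0) (iota 0 m).

(** A sigma type, since [ev] needs the root as data. *)
Lemma cube_root_exists : {w : C | w ^+ 2 = - 1 - w & w^* = - 1 - w}.
Proof.
have sqrt3 : (sqrtC 3)^* = sqrtC 3 :> C.
  by apply: conj_Creal; rewrite ger0_real // sqrtC_ge0 ler0n.
have sqr3 : sqrtC 3 ^+ 2 = 3 :> C by rewrite sqrtCK.
have sqri := sqrCi C.
have two0 : 2 != 0 :> C by rewrite pnatr_eq0.
exists ((- 1 + 'i * sqrtC 3) / 2).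
  by field: sqr3 sqri.
rewrite rmorphM rmorphD rmorphM /= conjCi sqrt3 rmorphN rmorph1 fmorphV rmorph_nat.
by field.
Qed.

Definition ev (x : eis) : C := x.1%:~R + x.2%:~R * s2val cube_root_exists.

Lemma evM x y : ev (emul x y) = ev x * ev y.
Proof.
rewrite /ev; case: cube_root_exists => w /= w2 _.
rewrite !(rmorphD, rmorphN, rmorphM) /=.
by ring: w2.
Qed.

Lemma evD x y : ev (eadd x y) = ev x + ev y.
Proof. by rewrite /ev !rmorphD /=; ring. Qed.

Lemma ev_conj x : ev (econj x) = (ev x)^*.
Proof.
rewrite /ev; case: cube_root_exists => w /= _ wc.
by rewrite !(rmorphD, rmorphN, rmorphM) /= !rmorph_int wc; ring.
Qed.

Lemma ev_int m : ev (eint m) = m%:~R.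
Proof. by rewrite /ev mul0r addr0. Qed.

Lemma ev_sum m F : ev (esum m F) = \sum_(i < m) ev (F i).
Proof.
rewrite -(big_mkord xpredT (ev \o F)) /esum /index_iota subn0.
elim: (iota 0 m) => [|i r IHr] /=; first by rewrite big_nil ev_int.
by rewrite evD IHr big_cons.
Qed.

Definition omega_pow (e : nat) : eis := nth (eint 0) [:: (1, 0); (0, 1); (-1, -1)] e.

(* The inner table lists exponents of [w]; its off-diagonal core is the
   1-factorization of [K_4] coloured by [0, 1, 2].  The exponent 3 is out of
   range for [omega_pow] and gives 0. *)
Definition conf5 (i j : nat) : eis :=
  omega_pow (nth 0%N (nth [::] [:: [:: 3; 0; 0; 0; 0];
                                   [:: 0; 3; 0; 1; 2];
                                   [:: 0; 0; 3; 2; 1];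
                                   [:: 0; 1; 2; 3; 0];
                                   [:: 0; 2; 1; 0; 3]]%N i) j).

(* Tensor products of the real Pauli matrices [I], [X], [Z] and [Y = X Z],
   chosen to anticommute pairwise. *)
Definition gamma5 (i a b : nat) : int :=
  let X := [:: [:: 0; 1]; [:: 1; 0]] in
  let Z := [:: [:: 1; 0]; [:: 0; -1]] in
  let Y := [:: [:: 0; -1]; [:: 1; 0]] in
  let I := [:: [:: 1; 0]; [:: 0; 1]] in
  let AB := nth (I, I) [:: (X, I); (Z, I); (Y, X); (Y, Z); (Y, Y)] i in
  nth 0 (nth [::] AB.1 (a %/ 2)) (b %/ 2) * nth 0 (nth [::] AB.2 (a %% 2)) (b %% 2).

(** Twice the block [u_ij]: the factor 1/2 is left to [u5], so that all checks are exact integer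
    computations. *)
Definition block5 (i j a b : nat) : eis :=
  emul (conf5 i j) (esum 4 (fun c => eint (gamma5 i a c * gamma5 j c b))).

Definition block5_check_skew : bool :=
  all (fun i => all (fun j => all (fun a => all (fun b =>
   eadd (block5 i j a b) (block5 j i a b) == eint 0)
  (iota 0 4)) (iota 0 4)) (iota 0 5)) (iota 0 5).

(** The 4 counts the nonzero entries in a row of [conf5]. *)
Definition block5_check_orth : bool :=
  all (fun i => all (fun i' => all (fun a => all (fun a' =>
   esum 5 (fun j => esum 4 (fun b => emul (block5 i j a b) (econj (block5 i' j a' b)))) ==
   eint (if (i == i') && (a == a') then 4 else 0))
  (iota 0 4)) (iota 0 4)) (iota 0 5)) (iota 0 5).

(** Here 4 is the trace of the identity of [M_4]. *)
Definition block5_check_trace : bool :=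
  all (fun i => all (fun j => all (fun k => all (fun l =>
   esum 4 (fun a => esum 4 (fun b => emul (econj (block5 i j a b)) (block5 k l a b))) ==
   eint (4 * (((i == k) && (j == l))%:R - ((i == l) && (j == k))%:R)))
  (iota 0 5)) (iota 0 5)) (iota 0 5)) (iota 0 5).

Lemma all_iotaP (p : pred nat) (m : nat) :
  reflect (forall i : 'I_m, p i) (all p (iota 0 m)).
Proof.
apply: (iffP allP) => pm i; first by apply: pm; rewrite mem_iota ltn_ord.
by rewrite mem_iota => im; apply: (pm (Ordinal im)).
Qed.

Lemma block5_skew (i j : 'I_5) (a b : 'I_4) :
  eadd (block5 i j a b) (block5 j i a b) = eint 0.
Proof.
have : block5_check_skew by vm_compute.
move/all_iotaP/(_ i)/all_iotaP/(_ j)/all_iotaP/(_ a)/all_iotaP/(_ b).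
by move/eqP.
Qed.

Lemma block5_orth (i i' : 'I_5) (a a' : 'I_4) :
  esum 5 (fun j => esum 4 (fun b => emul (block5 i j a b) (econj (block5 i' j a' b)))) =
  eint (if (i == i') && (a == a') then 4 else 0).
Proof.
have : block5_check_orth by vm_compute.
move/all_iotaP/(_ i)/all_iotaP/(_ i')/all_iotaP/(_ a)/all_iotaP/(_ a').
by move/eqP.
Qed.

Lemma block5_trace (i j k l : 'I_5) :
  esum 4 (fun a => esum 4 (fun b => emul (econj (block5 i j a b)) (block5 k l a b))) =
  eint (4 * (((i == k) && (j == l))%:R - ((i == l) && (j == k))%:R)).
Proof.
have : block5_check_trace by vm_compute.
move/all_iotaP/(_ i)/all_iotaP/(_ j)/all_iotaP/(_ k)/all_iotaP/(_ l).
by move/eqP.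
Qed.

Definition u5 (i j a b : nat) : C := ev (block5 i j a b) / 2.

(** Indices of [f] are naturals so that [extend2] can shift them by pattern matching. *)
Definition skew_unitary (n k : nat) (f : nat -> nat -> nat -> nat -> C) : Prop :=
  (forall (i j : 'I_n) (a b : 'I_k), f i j a b = - f j i a b) /\
  row_orthonormal (fun (i j : 'I_n) (a b : 'I_k) => f i j a b).

Lemma conj_half (x : C) : (x / 2)^* = x^* / 2.
Proof. by rewrite rmorphM fmorphV /= rmorph_nat. Qed.

Lemma u5_skew_unitary : skew_unitary 5 4 u5.
Proof.
split=> [i j a b|i i' a a'].
  apply/eqP; rewrite -addr_eq0 -mulrDl -evD block5_skew ev_int.
  by rewrite mulr0z mul0r.
transitivity (ev (esum 5 (fun j => esum 4 (fun b =>
   emul (block5 i j a b) (econj (block5 i' j a' b))))) / 4).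
  rewrite ev_sum mulr_suml; apply: eq_bigr => j _.
  rewrite ev_sum mulr_suml; apply: eq_bigr => b _.
  by rewrite evM ev_conj /u5 conj_half; field.
rewrite block5_orth ev_int; case: ifP => _ /=; last by rewrite mulr0z mul0r.
by rewrite mulfV // pnatr_eq0.
Qed.

Lemma u5_trace (i j k l : 'I_5) :
  \sum_(a < 4) \sum_(b < 4) (u5 i j a b)^* * u5 k l a b =
  (i == k)%:R * (j == l)%:R - (i == l)%:R * (j == k)%:R.
Proof.
transitivity (ev (esum 4 (fun a => esum 4 (fun b =>
   emul (econj (block5 i j a b)) (block5 k l a b)))) / 4).
  rewrite ev_sum mulr_suml; apply: eq_bigr => a _.
  rewrite ev_sum mulr_suml; apply: eq_bigr => b _.
  by rewrite evM ev_conj /u5 conj_half; field.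
rewrite block5_trace ev_int rmorphM rmorphB /= !rmorph_nat -!mulnb !natrM.
by field.
Qed.

(** * Extension to all odd orders, two block indices at a time *)

Definition extend2 (f : nat -> nat -> nat -> nat -> C) (i j a b : nat) : C :=
  match i, j with
  | 0, 1 => (a == b)%:R
  | 1, 0 => - (a == b)%:R
  | i'.+2, j'.+2 => f i' j' a b
  | _, _ => 0
  end.

Lemma extend2_skew_unitary (n k : nat) f :
  skew_unitary n k f -> skew_unitary n.+2 k (extend2 f).
Proof.
move=> [fN fO]; split.
  case=> [[|[|i]] hi] [[|[|j]] hj] a b /=; rewrite ?oppr0 ?opprK //.
  exact: (fN (Ordinal (hi : (i < n)%N)) (Ordinal (hj : (j < n)%N))).
have sum0l m (F : 'I_m -> C) : \sum_b 0 * F b = 0.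
  by apply: big1 => b _; rewrite mul0r.
have sum0r m (F : 'I_m -> C) : \sum_b F b * 0^* = 0.
  by apply: big1 => b _; rewrite conjC0 mulr0.
have dsum0l (F : 'I_n -> 'I_k -> C) : \sum_j \sum_b 0 * F j b = 0.
  by apply: big1 => j _; apply: sum0l.
have dsum0r (F : 'I_n -> 'I_k -> C) : \sum_j \sum_b F j b * 0^* = 0.
  by apply: big1 => j _; apply: sum0r.
have delta_sum (a a' : 'I_k) :
    \sum_(b < k) (a == b)%:R * ((a' == b)%:R)^* = (a == a')%:R :> C.
  rewrite (bigD1 a) //= big1 => [|b /negPf ba]; last by rewrite eq_sym ba mul0r.
  by rewrite eqxx mul1r addr0 eq_sym rmorph_nat.
(* Block row 0, block row 1 and the old block rows occupy disjoint block columns, so all mixed cases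
   vanish. *)
case=> [[|[|i]] hi] [[|[|i']] hi'] a a'; rewrite !big_ord_recl /=;
  rewrite ?dsum0l ?dsum0r ?sum0l ?sum0r ?addr0 ?add0r //.
- by rewrite delta_sum.
- rewrite -delta_sum; apply: eq_bigr => b _.
  by rewrite rmorphN mulrNN.
- exact: (fO (Ordinal (hi : (i < n)%N)) (Ordinal (hi' : (i' < n)%N))).
Qed.

Lemma odd_skew_unitary n : (5 <= n)%N -> odd n -> exists f, skew_unitary n 4 f.
Proof.
move=> n5 on; have -> : n = ((n - 5)./2.*2 + 5)%N.
  by rewrite even_halfK ?subnK // oddB // on.
elim: _./2 => [|m [f fP]]; first by exists u5; apply: u5_skew_unitary.
by exists (extend2 f); apply: extend2_skew_unitary.
Qed.

Theorem theorem5p2 :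
  (exists u : 'M[C]_(5 * 4), unitary u /\
     forall x : 'M[C]_5,
       Wminus x = id_tens_tau (autconj u (x *t (1%:M : 'M[C]_4))))
  /\
  (forall n : nat, (5 <= n)%N -> odd n ->
     in_conv_Aut (tensmap (@Wminus n) (@Sdep 4))).
Proof.
split=> [|n n5 odd_n]; last first.
  by have [f [fN fO]] := odd_skew_unitary n5 odd_n;
    apply: in_conv_Aut_Wminus_Sdep fN fO.
have [uN uO] := u5_skew_unitary.
exists (blockmx (fun (i j : 'I_5) (a b : 'I_4) => u5 i j a b)).
split=> [|x]; first exact: unitary_blockmx.
apply/matrixP => j l; rewrite id_tens_tauE.
under eq_bigr => i _ do under eq_bigr => i' _ do rewrite u5_trace mulrBr.
(* The prefactors agree because [n - 1] and [k] are both 4. *)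
rewrite !mxE; congr (_ * _).
under eq_bigr => i _ do rewrite sumrB.
(* The first sum is the trace term, the second picks the transposed entry [x l j]. *)
rewrite sumrB; congr (_ - _).
  rewrite mulr_suml; apply: eq_bigr => i _.
  rewrite (bigD1 i) //= big1 => [|i' /negPf i'i]; last first.
    by rewrite eq_sym i'i mul0r mulr0.
  by rewrite eqxx mul1r addr0.
rewrite (bigD1 l) //= [X in _ + X]big1 => [|i /negPf il]; last first.
  by apply: big1 => i' _; rewrite il mul0r mulr0.
rewrite (bigD1 j) //= big1 => [|i' /negPf i'j]; last first.
  by rewrite eq_sym i'j !mulr0.
by rewrite !eqxx !mulr1 !addr0.
Qed.
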